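(* Let $n\ge4$ and $1\le s\le n$ be integers, let $u=(u_{ij})$ be the fundamental corepresentation of $A_s(n)$ with Haar state $\int$, and let $X=u_{11}+\cdots+u_{ss}$. Then $$\int X=\frac{s}{n},\qquad \int X^2=\frac{s}{n}\cdot\frac{n+(s-2)}{n-1},\qquad \int X^3=\frac{s}{n}\cdot\frac{n^2+3(s-2)n+(s^2-9s+10)}{(n-1)(n-2)},$$ $$\int X^4=\frac{s}{n}\cdot\frac{P_s(n)}{(n-1)(n-2)(n^2-3n+1)},$$ where $P_s(n)=n^4+(6s-12)n^3+(6s^2-46s+52)n^2+(s^3-26s^2+104s-88)n+(12s^2-38s+28)$.
   Context: A magic unitary is a square matrix over a C*-algebra whose entries are projections such that the entries of each row and of each column are mutually orthogonal and sum to $1$. $A_s(n)$ is the universal C*-algebra generated by $n^2$ elements $u_{ij}$ subject to the relations making $u=(u_{ij})$ a magic unitary; it is a compact quantum group with comultiplication $\Delta(u_{ij})=\sum_k u_{ik}\otimes u_{kj}$, and $u$ is its fundamental corepresentation. The Haar state $\int$ is the unique state $h$ with $(h\otimes \mathrm{id})\Delta=(\mathrm{id}\otimes h)\Delta=h(\cdot)1$. *)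

(* Defs.v *)
From HB Require Import structures.
From mathcomp Require Import all_boot all_order all_algebra.
From mathcomp Require Import reals complex.

Set Implicit Arguments.
Unset Strict Implicit.
Unset Printing Implicit Defensive.

Import Order.TTheory GRing.Theory Num.Theory.

Local Open Scope ring_scope.

(* Unital complex C*-algebras. The norm is an R-valued function rather than the
   norm of a normedModType, because Hierarchy Builder accepts no structure on
   top of both GRing.Algebra and NormedModule (in the hierarchy, the join of
   rings and normed groups is numDomainType). An algType is a nonzero ring; the
   zero algebra is thereby left out. *)
HB.mixin Record isCStarAlgebra (R : realType) A of GRing.Algebra R[i] A := {
  star : A -> A;
  cnorm : A -> R;
  starK : forall x : A, star (star x) = x;
  starD : forall x y : A, star (x + y) = star x + star y;
  starM : forall x y : A, star (x * y) = star y * star x;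
  starZ : forall (a : R[i]) (x : A), star (a *: x) = a^* *: star x;
  cnorm_eq0 : forall x : A, cnorm x = 0 -> x = 0;
  cnormZ : forall (a : R[i]) (x : A), cnorm (a *: x) = Normc.normc a * cnorm x;
  cnormD : forall x y : A, cnorm (x + y) <= cnorm x + cnorm y;
  cnormM : forall x y : A, cnorm (x * y) <= cnorm x * cnorm y;
  cnorm_cstar : forall x : A, cnorm (star x * x) = cnorm x ^+ 2;
  cnorm_complete : forall x : nat -> A,
    (forall e : R, 0 < e -> exists N, forall j k, (N <= j)%N -> (N <= k)%N ->
       cnorm (x j - x k) < e) ->
    exists y : A, forall e : R, 0 < e -> exists N, forall k, (N <= k)%N ->
       cnorm (x k - y) < e
}.

#[short(type="cstarType")]
HB.structure Definition CStarAlgebra (R : realType) :=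
  {A of isCStarAlgebra R A & GRing.Algebra R[i] A}.

Definition norm_closed (R : realType) (A : cstarType R) (S : A -> Prop) :
    Prop :=
  forall x, (forall e : R, 0 < e -> exists2 y, S y & cnorm (x - y) < e) -> S x.

Definition norm_dense (R : realType) (A : cstarType R) (S : A -> Prop) : Prop :=
  forall x (e : R), 0 < e -> exists2 y, S y & cnorm (x - y) < e.

Definition norm_continuous (R : realType) (A B : cstarType R) (f : A -> B) :
    Prop :=
  forall x (e : R), 0 < e -> exists2 d : R, 0 < d &
    forall y, cnorm (x - y) < d -> cnorm (f x - f y) < e.

(* {lrmorphism A -> B} is a unital algebra morphism; a unital *-homomorphism is
   one that satisfies this predicate. Its continuity is automatic. *)
Definition star_preserving (R : realType) (A B : cstarType R) (f : A -> B) :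
    Prop :=
  forall x, f (star x) = star (f x).

Definition is_projection (R : realType) (A : cstarType R) (p : A) : Prop :=
  star p = p /\ p * p = p.

Record magic_unitary (R : realType) (A : cstarType R) (n : nat)
    (u : 'M[A]_n) : Prop := MagicUnitary {
  magic_proj : forall i j, is_projection (u i j);
  magic_row_orth : forall i j k, j != k -> u i j * u i k = 0;
  magic_col_orth : forall i j k, i != j -> u i k * u j k = 0;
  magic_row_sum : forall i, \sum_j u i j = 1;
  magic_col_sum : forall j, \sum_i u i j = 1
}.

Record closed_star_subalgebra (R : realType) (A : cstarType R) (S : A -> Prop) :
    Prop := ClosedStarSubalgebra {
  css_closed : norm_closed S;
  css_1 : S 1;
  css_D : forall x y, S x -> S y -> S (x + y);
  css_Z : forall (a : R[i]) x, S x -> S (a *: x);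
  css_M : forall x y, S x -> S y -> S (x * y);
  css_star : forall x, S x -> S (star x)
}.

(* (A, u) is A_s(n): A is generated, as a C*-algebra, by the entries of the
   magic unitary u, and every magic unitary of the same size over a C*-algebra
   is the image of u under a *-homomorphism. *)
Record quantum_permutation_algebra (R : realType) (A : cstarType R) (n : nat)
    (u : 'M[A]_n) : Prop := QuantumPermutationAlgebra {
  qpa_magic : magic_unitary u;
  qpa_generated : forall S : A -> Prop, closed_star_subalgebra S ->
    (forall i j, S (u i j)) -> forall x, S x;
  qpa_universal : forall (B : cstarType R) (v : 'M[B]_n), magic_unitary v ->
    exists f : {lrmorphism A -> B},
      star_preserving f /\ forall i j, f (u i j) = v i j
}.

Definition linearly_independent (R : realType) (V : lmodType R[i]) (m : nat)
    (b : 'I_m -> V) : Prop :=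
  forall c : 'I_m -> R[i], \sum_k c k *: b k = 0 -> forall k, c k = 0.

(* T is a C*-algebraic tensor product of A and B, i.e. a completion of the
   algebraic tensor product for a C*-norm (the minimal and the maximal one are
   instances), where l a = a (x) 1 and r b = 1 (x) b, so that the elementary
   tensor a (x) b is l a * r b. The field cst_inj says that the canonical map
   from the algebraic tensor product to T is injective. *)
Record cstar_tensor (R : realType) (A B T : cstarType R)
    (l : {lrmorphism A -> T}) (r : {lrmorphism B -> T}) : Prop := CStarTensor {
  cst_starl : star_preserving l;
  cst_starr : star_preserving r;
  cst_comm : forall a b, l a * r b = r b * l a;
  cst_inj : forall (m : nat) (a : 'I_m -> A) (b : 'I_m -> B),
    linearly_independent b -> \sum_k l (a k) * r (b k) = 0 ->
    forall k, a k = 0;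
  cst_dense : norm_dense (fun t : T =>
    exists m (a : 'I_m -> A) (b : 'I_m -> B), t = \sum_k l (a k) * r (b k))
}.

Definition is_comultiplication (R : realType) (A T : cstarType R)
    (l r : {lrmorphism A -> T}) (n : nat) (u : 'M[A]_n)
    (Delta : {lrmorphism A -> T}) : Prop :=
  star_preserving Delta /\
  forall i j, Delta (u i j) = \sum_k l (u i k) * r (u k j).

Definition is_state (R : realType) (A : cstarType R) (h : {scalar A}) : Prop :=
  (forall x, 0 <= h (star x * x)) /\ h 1 = 1.

(* F = h (x) id, the continuous linear map with a (x) b |-> h(a) b; by density
   of the algebraic tensor product there is at most one. *)
Definition is_state_tensor_id (R : realType) (A T : cstarType R)
    (l r : {lrmorphism A -> T}) (h : {scalar A}) (F : {linear T -> A}) : Prop :=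
  norm_continuous F /\ forall a b, F (l a * r b) = h a *: b.

(* F = id (x) h *)
Definition is_id_tensor_state (R : realType) (A T : cstarType R)
    (l r : {lrmorphism A -> T}) (h : {scalar A}) (F : {linear T -> A}) : Prop :=
  norm_continuous F /\ forall a b, F (l a * r b) = h b *: a.

Record is_haar_state (R : realType) (A T : cstarType R)
    (l r : {lrmorphism A -> T}) (Delta : {lrmorphism A -> T})
    (h : {scalar A}) : Prop := IsHaarState {
  haar_state : is_state h;
  haar_left : exists F : {linear T -> A},
    is_state_tensor_id l r h F /\ forall x, F (Delta x) = h x *: 1;
  haar_right : exists F : {linear T -> A},
    is_id_tensor_state l r h F /\ forall x, F (Delta x) = h x *: 1
}.

(* u_11 + ... + u_ss; the ordinals of 'I_n start at 0, hence i < s. *)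
Definition truncated_character (R : realType) (A : cstarType R) (n s : nat)
    (u : 'M[A]_n) : A :=
  \sum_(i < n | (i < s)%N) u i i.

(* Main.v *)
From HB Require Import structures.
Require Import Defs.
From mathcomp Require Import all_boot all_order all_algebra perm.
From mathcomp Require Import boolp classical_sets reals complex.
From mathcomp Require Import ring lra.

Set Implicit Arguments.
Unset Strict Implicit.
Unset Printing Implicit Defensive.

Import Order.TTheory GRing.Theory Num.Theory.
Local Open Scope sesquilinear_scope.
Local Open Scope ring_scope.

(* Composing the left invariance of h with a *-homomorphism A -> B that sends u
   to a magic unitary v gives
     sum_k h(u_(i1 k1) .. u_(im km)) v_(k1 j1) .. v_(km jm)
       = h(u_(i1 j1) .. u_(im jm)) 1.
   For permutation matrices v this says that the moments of h are invariant
   under permutations of the column indices. Summing over one column index, one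
   gets all moments of degree at most 3, and linear relations that leave one
   degree of freedom per row pattern in degree 4, due to the crossing partition
   {1,3},{2,4}. It is removed by a v over the 2x2 matrices with two diagonal
   blocks (p, 1-p; 1-p, p) and (q, 1-q; 1-q, q) where p, q do not commute: the
   relation above then says that the crossing partition has coefficient 0 in the
   moments, seen as functions of the columns. *)

(** * The C*-algebra of complex matrices *)

(* Sealed: unification would otherwise unfold these norms down to suprema. *)
HB.lock Definition vnorm (R : realType) (n : nat) (v : 'rV[R[i]]_n) : R :=
  complex.Re (sqrtC (dotmx v v)).

HB.lock Definition opnorm (R : realType) (n : nat) (x : 'M[R[i]]_n) : R :=
  inf [set c : R | 0 <= c /\
                   forall v : 'rV_n, vnorm (v *m x) <= c * vnorm v]%classic.

Section VectorNorm.
Variables (R : realType) (n : nat).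
Local Notation C := R[i].
Implicit Types (u v : 'rV[C]_n) (a : C).

Lemma vnormE v : (vnorm v)%:C%C = sqrtC (dotmx v v).
Proof.
by rewrite vnorm.unlock RRe_real // ger0_real // sqrtC_ge0 dnorm_ge0.
Qed.

Lemma vnorm_ge0 v : 0 <= vnorm v.
Proof. by rewrite -ler0c vnormE sqrtC_ge0 dnorm_ge0. Qed.

Lemma sqr_vnorm v : (vnorm v ^+ 2)%:C%C = dotmx v v.
Proof. by rewrite rmorphXn /= vnormE sqrtCK. Qed.

Lemma vnorm_eq0 v : (vnorm v == 0) = (v == 0).
Proof. by rewrite -(inj_eq (@complexI R)) vnormE sqrtC_eq0 dnorm_eq0. Qed.

Lemma vnormZ a v : vnorm (a *: v) = Normc.normc a * vnorm v.
Proof.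
apply: (@complexI R); rewrite rmorphM /= !vnormE dnormZ.
by rewrite sqrtCM ?nnegrE ?exprn_ge0 ?dnorm_ge0 // sqrCK.
Qed.

Lemma vnormD u v : vnorm (u + v) <= vnorm u + vnorm v.
Proof. by rewrite -lecR rmorphD /= !vnormE; apply: triangle_lerif. Qed.

Lemma vnorm_CauchySchwarz u v : Normc.normc (dotmx u v) <= vnorm u * vnorm v.
Proof. by rewrite -lecR rmorphM /= !vnormE; apply: CauchySchwarz_sqrt. Qed.

Lemma vnorm_sum (I : finType) (F : I -> 'rV[C]_n) :
  vnorm (\sum_i F i) <= \sum_i vnorm (F i).
Proof.
elim/big_rec2: _ => [|i x y _ le_yx]; first by rewrite le_eqVlt vnorm_eq0 eqxx.
by rewrite (le_trans (vnormD _ _)) // lerD2l.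
Qed.

Lemma vnorm_delta i : vnorm (delta_mx 0 i : 'rV[C]_n) = 1.
Proof.
apply: (@complexI R); rewrite vnormE dotmxE mxE (bigD1 i) //= big1 => [|j ji].
  by rewrite !mxE !eqxx conjC1 mulr1 addr0 sqrtC1.
by rewrite !mxE (negbTE ji) mul0r.
Qed.

Lemma normc_le_vnorm v i : Normc.normc (v 0 i) <= vnorm v.
Proof.
suff <- : dotmx v (delta_mx 0 i) = v 0 i.
  by rewrite (le_trans (vnorm_CauchySchwarz _ _)) // vnorm_delta mulr1.
rewrite dotmxE mxE (bigD1 i) //= big1 => [|j ji].
  by rewrite !mxE !eqxx conjC1 mulr1 addr0.
by rewrite !mxE (negbTE ji) conjC0 mulr0.
Qed.

Lemma vnorm_le_sum v : vnorm v <= \sum_i Normc.normc (v 0 i).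
Proof.
rewrite {1}[v]row_sum_delta (le_trans (vnorm_sum _)) // ler_sum // => i _.
by rewrite vnormZ vnorm_delta mulr1.
Qed.

End VectorNorm.

Section OperatorNorm.
Variables (R : realType) (n : nat).
Local Notation C := R[i].
Implicit Types (x y : 'M[C]_n) (v : 'rV[C]_n).

(** This crude bound makes the set in [opnorm] nonempty, so that its infimum is meaningful, and it
    controls [opnorm] by the entries. *)
Lemma vnorm_mulmx_sum x v :
  vnorm (v *m x) <= (\sum_i \sum_j Normc.normc (x i j)) * vnorm v.
Proof.
rewrite mulmx_sum_row (le_trans (vnorm_sum _)) // mulr_suml ler_sum // => i _.
rewrite vnormZ mulrC ler_pM ?vnorm_ge0 ?normc_le_vnorm //.
  by rewrite -ler0c; apply: (@normr_ge0 _ C).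
by rewrite (le_trans (vnorm_le_sum _)) // ler_sum // => j _; rewrite mxE.
Qed.

Lemma sum_normc_ge0 x : 0 <= \sum_i \sum_j Normc.normc (x i j).
Proof.
do 2!apply: sumr_ge0 => ? _.
by rewrite -ler0c; apply: (@normr_ge0 _ C).
Qed.

Lemma opnorm_le x c : 0 <= c -> (forall v, vnorm (v *m x) <= c * vnorm v) ->
  opnorm x <= c.
Proof.
by move=> c0 xc; rewrite opnorm.unlock; apply: ge_inf => //; exists 0 => d [].
Qed.

Lemma opnorm_ge0 x : 0 <= opnorm x.
Proof.
rewrite opnorm.unlock; apply: lb_le_inf; last by move=> c [].
exists (\sum_i \sum_j Normc.normc (x i j)); split; first exact: sum_normc_ge0.
exact: vnorm_mulmx_sum.
Qed.

(** The infimum is attained: for nonzero [v], every admissible constant is at least the quotient of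
    the two vector norms. *)
Lemma vnorm_mulmx x v : vnorm (v *m x) <= opnorm x * vnorm v.
Proof.
have [->|v0] := eqVneq v 0.
  have /eqP v00 : vnorm (0 : 'rV[C]_n) == 0 by rewrite vnorm_eq0.
  by rewrite mul0mx v00 mulr0.
have vgt0 : 0 < vnorm v by rewrite lt0r vnorm_eq0 v0 vnorm_ge0.
rewrite -ler_pdivrMr // opnorm.unlock; apply: lb_le_inf; last first.
  by move=> c [_ xc]; rewrite ler_pdivrMr.
exists (\sum_i \sum_j Normc.normc (x i j)); split; first exact: sum_normc_ge0.
exact: vnorm_mulmx_sum.
Qed.

Lemma opnorm_le_sum x : opnorm x <= \sum_i \sum_j Normc.normc (x i j).
Proof. exact: opnorm_le (sum_normc_ge0 x) (vnorm_mulmx_sum x). Qed.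

Lemma normc_le_opnorm x i j : Normc.normc (x i j) <= opnorm x.
Proof.
have := vnorm_mulmx x (delta_mx 0 i); rewrite vnorm_delta mulr1.
rewrite -rowE; apply: le_trans.
by have := normc_le_vnorm (row i x) j; rewrite mxE.
Qed.

Lemma opnorm_eq0 x : opnorm x = 0 -> x = 0.
Proof.
move=> x0; apply/matrixP => i j; rewrite mxE; apply: Normc.eq0_normc.
apply/eqP; rewrite eq_le -{1}x0 normc_le_opnorm -ler0c.
exact: (@normr_ge0 _ C).
Qed.

Lemma opnormZ (a : C) x : opnorm (a *: x) = Normc.normc a * opnorm x.
Proof.
have N0 (b : C) : 0 <= Normc.normc b by rewrite -ler0c; apply: (@normr_ge0 _ C).
have leZ (b : C) y : opnorm (b *: y) <= Normc.normc b * opnorm y.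
  apply: opnorm_le => [|v]; first by rewrite mulr_ge0 ?opnorm_ge0.
  by rewrite -scalemxAr vnormZ -mulrA ler_wpM2l // vnorm_mulmx.
apply/le_anti; rewrite leZ /=.
have [->|a0] := eqVneq a 0; first by rewrite Normc.normc0 mul0r opnorm_ge0.
have a1 : 0 < Normc.normc a.
  by rewrite lt0r N0 andbT; apply: contra a0 => /eqP/Normc.eq0_normc ->.
(* The reverse inequality is [leZ] for the inverse scalar. *)
have := leZ a^-1 (a *: x); rewrite scalerA mulVf // scale1r Normc.normcV.
by rewrite (ler_pdivlMl _ _ a1).
Qed.

Lemma opnormD x y : opnorm (x + y) <= opnorm x + opnorm y.
Proof.
apply: opnorm_le => [|v]; first by rewrite addr_ge0 ?opnorm_ge0.
by rewrite mulmxDr mulrDl (le_trans (vnormD _ _)) // lerD ?vnorm_mulmx.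
Qed.

Lemma opnormM x y : opnorm (x *m y) <= opnorm x * opnorm y.
Proof.
apply: opnorm_le => [|v]; first by rewrite mulr_ge0 ?opnorm_ge0.
rewrite mulmxA (le_trans (vnorm_mulmx _ _)) // [opnorm x * _]mulrC -mulrA.
by rewrite ler_wpM2l ?opnorm_ge0 // vnorm_mulmx.
Qed.

(* [|v x^*|^2 = <v x^* x, v>], so the square of the norm of [x^*] is at most
   the norm of [x^* x]; submultiplicativity then gives [|x^*| <= |x|]. *)
Lemma sqr_opnorm_adj x : opnorm (x ^t*) ^+ 2 <= opnorm (x ^t* *m x).
Proof.
have c0 := opnorm_ge0 (x ^t* *m x).
rewrite -[leRHS]sqr_sqrtr // ler_pXn2r ?nnegrE ?opnorm_ge0 ?sqrtr_ge0 //.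
apply: opnorm_le => [|v]; first exact: sqrtr_ge0.
rewrite -(@ler_pXn2r _ 2) ?nnegrE ?vnorm_ge0 ?mulr_ge0 ?sqrtr_ge0 ?vnorm_ge0 //.
rewrite exprMn sqr_sqrtr // -[leLHS](@ger0_norm R) ?exprn_ge0 ?vnorm_ge0 //.
have -> : `|vnorm (v *m x ^t*) ^+ 2| =
          Normc.normc (dotmx (v *m (x ^t* *m x)) v).
  apply: (@complexI R); rewrite ger0_norm ?exprn_ge0 ?vnorm_ge0 // sqr_vnorm.
  have e : dotmx (v *m x ^t*) (v *m x ^t*) = dotmx (v *m (x ^t* *m x)) v.
    by rewrite !dotmxE trmx_mul map_mxM trmxCK !mulmxA.
  by rewrite -[RHS]/(`|dotmx _ v|) -e ger0_norm ?dnorm_ge0.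
rewrite (le_trans (vnorm_CauchySchwarz _ _)) // expr2 mulrA.
by rewrite ler_wpM2r ?vnorm_ge0 // vnorm_mulmx.
Qed.

Lemma opnorm_adj_le x : opnorm (x ^t*) <= opnorm x.
Proof.
have := le_trans (sqr_opnorm_adj x) (opnormM _ _); rewrite expr2.
have := opnorm_ge0 (x ^t*); rewrite le0r => /orP[/eqP->|x0].
  by rewrite opnorm_ge0.
by rewrite ler_pM2l.
Qed.

Lemma opnorm_adj x : opnorm (x ^t*) = opnorm x.
Proof. by apply/le_anti; rewrite opnorm_adj_le -{1}[x]trmxCK opnorm_adj_le. Qed.

Lemma opnorm_cstar x : opnorm (x ^t* *m x) = opnorm x ^+ 2.
Proof.
apply/le_anti; rewrite (le_trans (opnormM _ _)) ?opnorm_adj -?expr2 //.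
by have := sqr_opnorm_adj x; rewrite opnorm_adj.
Qed.

End OperatorNorm.

(** * Completeness of the operator norm *)

Section Completeness.
Variable R : realType.
Local Notation C := R[i].
Local Open Scope classical_set_scope.

(** The limit is the supremum of the eventual lower bounds of the sequence. For large [k] it lies
    within [e / 4] of [x k], which leaves room for the strict inequality. *)
Lemma real_cauchy_limit (x : nat -> R) :
  (forall e, 0 < e -> exists N, forall j k, (N <= j)%N -> (N <= k)%N ->
     `|x j - x k| < e) ->
  exists y, forall e, 0 < e -> exists N, forall k, (N <= k)%N -> `|x k - y| < e.
Proof.
move=> cx; pose S := [set r : R | exists N, forall k, (N <= k)%N -> r <= x k].
exists (sup S) => e e0; have e4 : 0 < e / 4 by rewrite divr_gt0.
have [N xN] := cx _ e4; exists N => k Nk.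
have bd j : (N <= j)%N -> x k - e / 4 <= x j <= x k + e / 4.
  by move=> Nj; have := xN _ _ Nj Nk; rewrite ltr_norml => /andP[? ?]; lra.
have Sx : S (x k - e / 4) by exists N => j /bd/andP[].
have ubS : ubound S (x k + e / 4).
  move=> r [M rM]; have := rM _ (leq_maxr N M).
  by have /andP[_] := bd _ (leq_maxl N M); lra.
have ? : x k - e / 4 <= sup S by apply: ub_le_sup => //; exists (x k + e / 4).
have ? : sup S <= x k + e / 4 by apply: ge_sup => //; exists (x k - e / 4).
by rewrite ltr_norml; lra.
Qed.

Lemma normc_le_ReIm (z : C) :
  Normc.normc z <= `|complex.Re z| + `|complex.Im z|.
Proof.
case: z => a b /=; rewrite -[leRHS]ger0_norm ?addr_ge0 // -[leRHS]sqrtr_sqr.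
rewrite ler_wsqrtr // sqrrD !real_normK ?num_real //.
by rewrite -addrA lerD2l lerDr mulrn_wge0 ?mulr_ge0.
Qed.

Lemma Re_le_normc (z : C) : `|complex.Re z| <= Normc.normc z.
Proof. by rewrite -lecR; apply: normc_ge_Re. Qed.

Lemma Im_le_normc (z : C) : `|complex.Im z| <= Normc.normc z.
Proof.
(* Up to sign, the imaginary part of [z] is the real part of [z] times the imaginary unit, which has
   modulus 1. *)
rewrite -normrN -ReiNIm (le_trans (Re_le_normc _)) // Normc.normcM.
by rewrite /Normc.normc /= expr0n expr1n /= add0r sqrtr1 mulr1.
Qed.

Lemma complex_cauchy_limit (x : nat -> C) :
  (forall e : R, 0 < e -> exists N, forall j k, (N <= j)%N -> (N <= k)%N ->
     Normc.normc (x j - x k) < e) ->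
  exists y, forall e : R, 0 < e ->
    exists N, forall k, (N <= k)%N -> Normc.normc (x k - y) < e.
Proof.
move=> cx.
have [a xa] : exists a, forall e : R, 0 < e -> exists N, forall k, (N <= k)%N ->
    `|complex.Re (x k) - a| < e.
  apply: real_cauchy_limit => e /cx[N xN]; exists N => j k Nj Nk.
  by rewrite -raddfB (le_lt_trans (Re_le_normc _)) ?xN.
have [b xb] : exists b, forall e : R, 0 < e -> exists N, forall k, (N <= k)%N ->
    `|complex.Im (x k) - b| < e.
  apply: real_cauchy_limit => e /cx[N xN]; exists N => j k Nj Nk.
  by rewrite -raddfB (le_lt_trans (Im_le_normc _)) ?xN.
exists (a +i* b)%C => e e0; have e2 : 0 < e / 2 by rewrite divr_gt0.
have [[N xN] [M xM]] := (xa _ e2, xb _ e2).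
exists (maxn N M) => k; rewrite geq_max => /andP[/xN xa_k /xM xb_k].
rewrite (le_lt_trans (normc_le_ReIm _)) // [e]splitr ltrD //.
  by rewrite raddfB.
by rewrite raddfB.
Qed.

Lemma opnorm_complete n (x : nat -> 'M[C]_n) :
  (forall e : R, 0 < e -> exists N, forall j k, (N <= j)%N -> (N <= k)%N ->
     opnorm (x j - x k) < e) ->
  exists y, forall e : R, 0 < e ->
    exists N, forall k, (N <= k)%N -> opnorm (x k - y) < e.
Proof.
move=> cx.
have /choice[y xy] (p : 'I_n * 'I_n) : exists y, forall e : R, 0 < e ->
    exists N, forall k, (N <= k)%N -> Normc.normc (x k p.1 p.2 - y) < e.
  apply: complex_cauchy_limit => e /cx[N xN]; exists N => j k Nj Nk.
  have := normc_le_opnorm (x j - x k) p.1 p.2; rewrite !mxE => /le_lt_trans->//.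
  exact: xN.
exists (\matrix_(i, j) y (i, j)) => e e0.
(* The successor keeps the denominator nonzero for [n = 0] and makes the sum over the [n * n]
   entries strictly smaller than [e]. *)
have d0 : 0 < e / (n * n).+1%:R by rewrite divr_gt0.
have /choice[N xN] p := xy p _ d0.
exists (\max_p N p) => k Nk; rewrite (le_lt_trans (opnorm_le_sum _)) //.
rewrite pair_big /=.
apply: (@le_lt_trans _ _ (\sum_(p : 'I_n * 'I_n) e / (n * n).+1%:R)).
  apply: ler_sum => -[i j] _; rewrite !mxE ltW // xN //.
  exact: leq_trans (leq_bigmax _) Nk.
rewrite sumr_const card_prod card_ord -[_ *+ (n * n)]mulr_natr mulrAC.
by rewrite ltr_pdivrMr ?ltr0n // ltr_pM2l // ltr_nat.
Qed.

End Completeness.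

Section MatrixStar.
Variables (R : realType) (n : nat).
Implicit Types x y : 'M[R[i]]_n.

Lemma adjD x y : (x + y) ^t* = x ^t* + y ^t*.
Proof. by rewrite linearD map_mxD. Qed.

Lemma adjM x y : (x *m y) ^t* = y ^t* *m x ^t*.
Proof. by rewrite trmx_mul map_mxM. Qed.

Lemma adjZ (a : R[i]) x : (a *: x) ^t* = a^* *: x ^t*.
Proof. by rewrite linearZ map_mxZ. Qed.

End MatrixStar.

(** Positive size ensures that 1 differs from 0. Size two hosts the noncommuting projections of
    [crossing]. *)
HB.instance Definition _ (R : realType) (n : nat) :=
  isCStarAlgebra.Build R 'M[R[i]]_n.+1 (@trmxCK _ _ _) (@adjD R _) (@adjM R _)
    (@adjZ R _) (@opnorm_eq0 R _) (@opnormZ R _) (@opnormD R _) (@opnormM R _)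
    (@opnorm_cstar R _) (@opnorm_complete R _).

(** * Relations between the moments of the Haar state *)

Section Projections.
Variables (R : realType) (A : cstarType R).

Lemma star0 : star (0 : A) = 0.
Proof. by apply: (@addIr _ (star 0)); rewrite -starD !add0r. Qed.

Lemma star1 : star (1 : A) = 1.
Proof. by rewrite -[LHS]mulr1 -[X in _ * X]starK -starM mulr1 starK. Qed.

Lemma starB (x y : A) : star (x - y) = star x - star y.
Proof. by apply: (@addIr _ (star y)); rewrite -starD !subrK. Qed.

Lemma projection0 : is_projection (0 : A).
Proof. by split; rewrite ?star0 ?mulr0. Qed.

Lemma projectionC (p : A) : is_projection p -> is_projection (1 - p).
Proof.
move=> [sp pp]; split; first by rewrite starB star1 sp.
by rewrite mulrBr mulr1 mulrBl mul1r pp subrr subr0.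
Qed.

(* For D = 0 this is the permutation matrix of tau. *)
Definition swap_mx (n : nat) (tau : 'I_n -> 'I_n) (D : 'I_n -> A) : 'M[A]_n :=
  \matrix_(i, j) (D i *+ (j == i) + (1 - D i) *+ (j == tau i)).

(** Row [i] holds the orthogonal projections [D i] and [1 - D i], which add up to a single entry 1
    if [tau] fixes [i]. Since [D] is constant on the orbits of [tau], the matrix is symmetric, and
    the column relations follow from those of the rows. *)
Lemma swap_mx_magic (n : nat) (tau : 'I_n -> 'I_n) (D : 'I_n -> A) :
  involutive tau -> (forall i, D (tau i) = D i) ->
  (forall i, is_projection (D i)) -> magic_unitary (swap_mx tau D).
Proof.
move=> tauK Dtau Dproj.
have Dorth i : D i * (1 - D i) = 0 /\ (1 - D i) * D i = 0.
  by have [_ pp] := Dproj i; rewrite mulrBr mulrBl mulr1 mul1r pp subrr.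
have sym i j : swap_mx tau D i j = swap_mx tau D j i.
  rewrite !mxE (eq_sym i j); congr (_ + _).
    by have [->|] := eqVneq j i.
  rewrite -(can_eq tauK j) tauK (eq_sym _ i).
  by have [->|] := eqVneq i (tau j); rewrite ?Dtau.
have orth i j k : j != k -> swap_mx tau D i j * swap_mx tau D i k = 0.
  move=> jk; rewrite !mxE; have [d1 d2] := Dorth i.
  have [ji|_] := eqVneq j i; have [ki|_] := eqVneq k i;
    have [jt|_] := eqVneq j (tau i); have [kt|_] := eqVneq k (tau i);
    rewrite ?mulr1n ?mulr0n ?addr0 ?add0r ?mulr0 ?mul0r ?d1 ?d2 //;
    by case/eqP: jk; congruence.
have rowsum i : \sum_j swap_mx tau D i j = 1.
  under eq_bigr do rewrite mxE; rewrite big_split /= (bigD1 i) //= eqxx mulr1n.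
  rewrite big1 => [|j /negbTE->]; last by rewrite mulr0n.
  rewrite (bigD1 (tau i)) //= eqxx mulr1n.
  rewrite big1 => [|j /negbTE->]; last by rewrite mulr0n.
  by rewrite !addr0 subrKC.
split.
- move=> i j; rewrite mxE.
  have [_|_] := eqVneq j i; have [_|_] := eqVneq j (tau i);
    rewrite ?mulr1n ?mulr0n ?addr0 ?add0r ?subrKC //;
    first 2 [exact: projectionC|exact: projection0].
  by split; rewrite ?star1 ?mulr1.
- exact: orth.
- by move=> i j k ij; rewrite sym (sym j) orth.
- exact: rowsum.
- by move=> j; under eq_bigr do rewrite sym; exact: rowsum.
Qed.

End Projections.

(** * Projections among the complex matrices of size two *)

Section TwoByTwo.
Variable R : realType.
Local Notation C := R[i].

Definition mx22 (a b c d : C) : 'M[C]_2 :=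
  \matrix_(i, j) (if i == 0 then if j == 0 then a else b
                  else if j == 0 then c else d).

Lemma eq_mx22 (M : 'M[C]_2) : M = mx22 (M 0 0) (M 0 1) (M 1 0) (M 1 1).
Proof.
apply/matrixP => i j; rewrite mxE.
case: i => [[|[|i]] lti] //; case: j => [[|[|j]] ltj] //=;
  by congr (M _ _); exact: val_inj.
Qed.

Lemma mx22M a b c d a' b' c' d' : mx22 a b c d * mx22 a' b' c' d' =
  mx22 (a * a' + b * c') (a * b' + b * d') (c * a' + d * c') (c * b' + d * d').
Proof. by rewrite [LHS]eq_mx22 !mxE !big_ord_recl !big_ord0 !mxE /= !addr0. Qed.

Lemma mx22C a b c d : 1 - mx22 a b c d = mx22 (1 - a) (- b) (- c) (1 - d).
Proof. by rewrite [LHS]eq_mx22 !mxE /= !sub0r. Qed.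

Lemma mx22_projection a b c d : a^* = a -> b^* = c -> d^* = d ->
  a * a + b * c = a -> a * b + b * d = b -> c * a + d * c = c ->
  c * b + d * d = d ->
  is_projection (mx22 a b c d).
Proof.
move=> aJ bJ dJ aa bb cc dd; have cJ : c^* = b by rewrite -bJ conjCK.
split.
  rewrite [LHS](_ : _ = map_mx Num.conj (mx22 a b c d)^T) //.
  by rewrite [LHS]eq_mx22 !mxE /= aJ bJ cJ dJ.
by rewrite mx22M aa bb cc dd.
Qed.

End TwoByTwo.

(** This serves sums over one index of a word: the indices already used are listed in [l], and
    symmetry makes the other terms equal. Their number is written as a difference in [K], a form
    suited to [field]. *)
Lemma sum_uniq_const (K : pzRingType) (I : finType) (P : pred I) (F : I -> K)
    (l : seq I) v :
    uniq l -> all P l -> (forall x, P x -> x \notin l -> F x = v) ->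
  \sum_(x | P x) F x = \sum_(x <- l) F x + (#|P|%:R - (size l)%:R) * v.
Proof.
move=> l_uniq /allP l_P Fv; rewrite (bigID [in l]) /=; congr (_ + _).
  rewrite big_uniq //; apply: eq_bigl => x.
  by have [/l_P->|_] := boolP (x \in l); rewrite ?andbT ?andbF.
under eq_bigr => x /andP[Px xl] do rewrite Fv //.
rewrite sumr_const -[v *+ _]mulr_natl; congr (_ * _).
apply: (@addIr _ (size l)%:R); rewrite subrK -natrD; congr _%:R.
rewrite -(card_uniqP l_uniq) addnC -(cardID [in l] P); congr (_ + _)%N.
  apply: eq_card => x; rewrite !inE /=.
  by have [/l_P|] := boolP (x \in l); rewrite ?andbF ?andbT.
by apply: eq_card => x; rewrite !inE andbC.
Qed.

Lemma exists_notin n (s : seq 'I_n) : (size s < n)%N -> exists i, i \notin s.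
Proof.
move=> sn; apply/existsP; rewrite -negb_forall; apply: contraL sn.
move=> /forallP s_all; rewrite -leqNgt; apply: leq_trans (card_size s).
by rewrite -{1}(card_ord n) eq_leq //; apply: eq_card => i; rewrite s_all.
Qed.

Lemma denominator_neq0 (K : numDomainType) n : (4 <= n)%N ->
  n%:R ^+ 2 - 3 * n%:R + 1 != 0 :> K.
Proof.
(* Written as [n * (n - 3) + 1], the polynomial is the image of a positive natural number. *)
move=> n4; have -> : n%:R ^+ 2 - 3 * n%:R + 1 = (n * (n - 3) + 1)%:R :> K.
  by rewrite natrD natrM natrB ?(leq_trans _ n4) //; ring.
by rewrite pnatr_eq0 addn1.
Qed.

(** * Words in the generators and the invariance of the Haar state *)

Section HaarWords.
Variables (R : realType) (n : nat) (A : cstarType R) (u : 'M[A]_n).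
Hypothesis hA : quantum_permutation_algebra u.
Variables (T : cstarType R) (l r : {lrmorphism A -> T}) (hT : cstar_tensor l r).
Variable Delta : {lrmorphism A -> T}.
Hypothesis hDelta : is_comultiplication l r u Delta.
Variables (h : {scalar A}) (hh : is_haar_state l r Delta h).

Definition word (s : seq ('I_n * 'I_n)) : A := \prod_(p <- s) u p.1 p.2.

(* For [s = [:: (i1, j1); ..; (im, jm)]] this is
   [sum_k h (a u_(i1 k1) .. u_(im km)) y v_(k1 j1) .. v_(km jm)]. *)
Fixpoint contract (B : cstarType R) (v : 'M[B]_n) (s : seq ('I_n * 'I_n))
    (a : A) (y : B) : B :=
  if s is p :: s' then \sum_k contract v s' (a * u p.1 k) (y * v k p.2)
  else h a *: y.

Lemma contractD (B : cstarType R) (v : 'M[B]_n) s a y z :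
  contract v s a (y + z) = contract v s a y + contract v s a z.
Proof.
elim: s a y z => [|p s IH] a y z /=; first by rewrite scalerDr.
by rewrite -big_split; apply: eq_bigr => k _; rewrite mulrDl IH.
Qed.

Lemma contract0 (B : cstarType R) (v : 'M[B]_n) s a : contract v s a 0 = 0.
Proof. by apply: (@addIr _ (contract v s a 0)); rewrite -contractD !add0r. Qed.

(** Left invariance says that slicing [Delta (word s)] by [h] gives the scalar [h (word s)]. The
    universal property carries this identity to [B], where the expansion of [Delta] over the letters
    becomes [contract]. *)
Lemma contract_word (B : cstarType R) (v : 'M[B]_n) s :
  magic_unitary v -> contract v s 1 1 = (h (word s))%:A.
Proof.
move=> /(qpa_universal hA)[f [_ fu]].
have [_ Du] := hDelta; have [F [[_ Flr] FD]] := haar_left hh.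
(* The prefix, an elementary tensor of [a] and [b], collects the letters already expanded, as the
   arguments of [contract] do. *)
suff E a b : f (F (l a * r b * Delta (word s))) = contract v s a (f b).
  by rewrite -(rmorph1 f) -E !rmorph1 !mul1r FD linearZ /= rmorph1.
elim: s a b => [|[i j] s IH] a b /=.
  by rewrite /word big_nil rmorph1 mulr1 Flr linearZ.
rewrite /word big_cons -/(word s) rmorphM /= Du mulrA mulr_sumr mulr_suml.
rewrite !linear_sum /=; apply: eq_bigr => k _.
rewrite -fu -rmorphM -IH !rmorphM /=; congr (f (F (_ * _))).
(* The two legs commute, so the new letter of the first leg moves past [r b] to join [l a]. *)
by rewrite -mulrA (mulrA (r b)) -(cst_comm hT) !mulrA.
Qed.

Lemma contract_swap (B : cstarType R) tau (D : 'I_n -> B) i j s a y :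
    involutive tau -> (forall i, D (tau i) = D i) ->
  contract (swap_mx tau D) ((i, j) :: s) a y =
  contract (swap_mx tau D) s (a * u i j) (y * D j) +
  contract (swap_mx tau D) s (a * u i (tau j)) (y * (1 - D j)).
Proof.
move=> tauK Dtau /=; set v := swap_mx tau D.
(* Each entry is split into its two summands, instead of the index set into cases, so that
   [tau j = j] is covered too. *)
transitivity (\sum_k ((if k == j then contract v s (a * u i k) (y * D k) else 0)
   + (if k == tau j then contract v s (a * u i k) (y * (1 - D k)) else 0))).
  apply: eq_bigr => k _; rewrite mxE mulrDr contractD eq_sym (eq_sym j).
  rewrite (can2_eq tauK tauK).
  by congr (_ + _); case: eqP => _; rewrite ?mulr1n // mulr0n mulr0 contract0.
by rewrite big_split -!big_mkcond !big_pred1_eq Dtau.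
Qed.

Definition moment s := h (word s).

Lemma moment_nil : moment [::] = 1.
Proof. by rewrite /moment /word big_nil; case: (haar_state hh). Qed.

(** Against a permutation matrix every sum in [contract] has one nonzero term, so [contract_word]
    relates just two moments. As 1 is nonzero in [A], their equality can be read off the
    coefficients of 1. *)
Lemma moment_involution tau s : involutive tau ->
  moment [seq (p.1, tau p.2) | p <- s] = moment s.
Proof.
move=> tauK; pose D (i : 'I_n) : A := 0.
have proj i : is_projection (D i) by exact: projection0.
have Dtau i : D (tau i) = D i by [].
have E a y : contract (swap_mx tau D) s a y =
    h (a * word [seq (p.1, tau p.2) | p <- s]) *: y.
  elim: s a y => [|[i j] s IH] a y; first by rewrite /word big_nil mulr1.
  rewrite contract_swap // mulr0 contract0 add0r subr0 mulr1 IH.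
  by rewrite /word /= big_cons mulrA.
have /eqP := contract_word s (swap_mx_magic tauK Dtau proj).
rewrite E mul1r -subr_eq0 -scalerBl scaler_eq0 oner_eq0 orbF subr_eq0.
by move/eqP.
Qed.

Lemma moment_tperm x y s :
  moment [seq (p.1, tperm x y p.2) | p <- s] = moment s.
Proof. exact/moment_involution/tpermK. Qed.


(** The word with columns a, c, b, c is contracted with the magic unitary that exchanges a with b
    through [p] and c with d through [q]. In the (0, 0) entry the first column stays a, and the
    symmetry between c and d leaves only the four moments of the statement. The resulting equation
    is half of the claimed one. *)
Lemma crossing i1 i2 i3 i4 a b c d : uniq [:: a; b; c; d] ->
  moment [:: (i1, a); (i2, c); (i3, a); (i4, c)]
  - moment [:: (i1, a); (i2, c); (i3, a); (i4, d)]
  - moment [:: (i1, a); (i2, c); (i3, b); (i4, c)]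
  + moment [:: (i1, a); (i2, c); (i3, b); (i4, d)] = 0.
Proof.
rewrite /= !inE !negb_or !andbT => /and3P[/and3P[ab ac ad] /andP[bc bd] cd].
pose tau x := tperm a b (tperm c d x).
have fixab x : x != a -> x != b -> tperm a b x = x.
  by move=> xa xb; rewrite tpermD // eq_sym.
have fixcd x : x != c -> x != d -> tperm c d x = x.
  by move=> xc xd; rewrite tpermD // eq_sym.
have ta : tau a = b by rewrite /tau fixcd // tpermL.
have tb : tau b = a by rewrite /tau fixcd // tpermR.
have tc : tau c = d by rewrite /tau tpermL fixab // eq_sym.
have td : tau d = c by rewrite /tau tpermR fixab // eq_sym.
have tauD x : x \notin [:: a; b; c; d] -> tau x = x.
  by rewrite !inE !negb_or => /and4P[xa xb xc xd]; rewrite /tau fixcd ?fixab.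
have tauK : involutive tau.
  move=> x; have [|/tauD e] := boolP (x \in [:: a; b; c; d]).
    by rewrite !inE => /or4P[]/eqP->; rewrite ?(ta, tb, tc, td).
  by rewrite !e.
(* These project onto the lines spanned by (1, 0) and (1, 1), which are neither parallel nor
   orthogonal, so they do not commute. *)
pose p : 'M[R[i]]_2 := mx22 1 0 0 0.
pose q : 'M[R[i]]_2 := mx22 2^-1 2^-1 2^-1 2^-1.
have pp : is_projection p.
  by apply: mx22_projection; rewrite ?conjC0 ?conjC1; ring.
have pq : is_projection q.
  by apply: mx22_projection; rewrite ?fmorphV ?conjC_nat; field.
pose D x := if x \in [:: c; d] then q else p.
have Dp x : is_projection (D x) by rewrite /D; case: ifP.
have [Da Db Dc Dd] : [/\ D a = p, D b = p, D c = q & D d = q].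
  rewrite /D !inE !eqxx !orbT.
  by rewrite (negbTE ac) (negbTE ad) (negbTE bc) (negbTE bd).
have Dtau x : D (tau x) = D x.
  have [|/tauD -> //] := boolP (x \in [:: a; b; c; d]).
  by rewrite !inE => /or4P[]/eqP->; rewrite ?(ta, tb, tc, td) ?(Da, Db, Dc, Dd).
have word4 k1 k2 k3 k4 : h (u i1 k1 * u i2 k2 * u i3 k3 * u i4 k4) =
    moment [:: (i1, k1); (i2, k2); (i3, k3); (i4, k4)].
  by rewrite /moment /word !big_cons big_nil mulr1 !mulrA.
have swapcd (y z : 'I_n) : y \in [:: a; b] ->
    moment [:: (i1, a); (i2, d); (i3, y); (i4, tperm c d z)] =
    moment [:: (i1, a); (i2, c); (i3, y); (i4, z)].
  move=> yab; rewrite -(moment_tperm c d) /= tpermR tpermK !fixcd //.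
  by move: yab; rewrite !inE => /orP[]/eqP->.
  by move: yab; rewrite !inE => /orP[]/eqP->.
have E := contract_word [:: (i1, a); (i2, c); (i3, b); (i4, c)]
  (swap_mx_magic tauK Dtau Dp).
move: E; rewrite !contract_swap // Da Db Dc ta tb tc /= !mul1r !word4.
rewrite -/(moment _).
have := swapcd a c; rewrite tpermL inE eqxx => -> //.
have := swapcd a d; rewrite tpermR inE eqxx => -> //.
have := swapcd b c; rewrite tpermL !inE eqxx orbT => -> //.
have := swapcd b d; rewrite tpermR !inE eqxx orbT => -> //.
(* In the (0, 0) entry the eight products that start with 1 - p vanish. *)
rewrite !mx22C !mx22M => /(congr1 (fun M : 'M_2 => M 0 0)).
rewrite !mxE /= => /eqP; rewrite -subr_eq0 => /eqP E.
rewrite -[RHS](mulr0 2) -E; by field.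
Qed.

(** * The magic relations in terms of moments *)

Lemma word_cat s1 s2 : word (s1 ++ s2) = word s1 * word s2.
Proof. by rewrite /word big_cat. Qed.

Lemma word_cons p s : word (p :: s) = u p.1 p.2 * word s.
Proof. by rewrite /word big_cons. Qed.

Let magic := qpa_magic hA.

Lemma moment_idem s1 s2 i j :
  moment (s1 ++ (i, j) :: (i, j) :: s2) = moment (s1 ++ (i, j) :: s2).
Proof.
rewrite /moment !word_cat !word_cons /= (mulrA (u i j)).
by rewrite (magic_proj magic i j).2.
Qed.

Lemma moment_row_orth s1 s2 i j k : j != k ->
  moment (s1 ++ (i, j) :: (i, k) :: s2) = 0.
Proof.
move=> jk; rewrite /moment word_cat !word_cons /= (mulrA (u i j)).
by rewrite (magic_row_orth magic) // mul0r mulr0 linear0.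
Qed.

Lemma moment_col_orth s1 s2 i j k : i != j ->
  moment (s1 ++ (i, k) :: (j, k) :: s2) = 0.
Proof.
move=> ij; rewrite /moment word_cat !word_cons /= (mulrA (u i k)).
by rewrite (magic_col_orth magic) // mul0r mulr0 linear0.
Qed.

Lemma moment_sum s1 s2 i :
  \sum_x moment (s1 ++ (i, x) :: s2) = moment (s1 ++ s2).
Proof.
rewrite /moment -linear_sum /=; congr (h _); rewrite word_cat.
under eq_bigr do rewrite word_cat word_cons mulrA.
by rewrite -mulr_suml -mulr_sumr (magic_row_sum magic) mulr1.
Qed.

(** The entries of row [i] sum to 1, which removes the inserted letter. As the remaining letters use
    only columns of [cs], a transposition identifies the contributions of any two columns outside
    [cs]. *)
Lemma moment_colsum s1 s2 i cs y : uniq cs -> y \notin cs ->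
    all (fun p => p.2 \in cs) (s1 ++ s2) ->
  \sum_(x <- cs) moment (s1 ++ (i, x) :: s2)
    + (n%:R - (size cs)%:R) * moment (s1 ++ (i, y) :: s2) = moment (s1 ++ s2).
Proof.
move=> cs_uniq ycs /allP s_cs; rewrite -(moment_sum s1 s2 i).
rewrite (@sum_uniq_const _ _ _ _ cs (moment (s1 ++ (i, y) :: s2))) //.
- by rewrite card_ord.
- exact/allP.
move=> x _ xcs; rewrite -(moment_tperm x y) map_cat /= tpermL.
have fix_s s : {subset s <= s1 ++ s2} ->
    [seq (p.1, tperm x y p.2) | p <- s] = s.
  move=> ss; rewrite -[RHS]map_id; apply/eq_in_map => -[j k] /ss/s_cs/= kcs.
  by rewrite tpermD //; [apply: contraNneq xcs | apply: contraNneq ycs] => ->.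
by rewrite !fix_s // => p; rewrite mem_cat => ->; rewrite ?orbT.
Qed.

Hypothesis n_ge4 : (4 <= n)%N.
Local Notation N := (n%:R : R[i]).

Let n_neq k : (k < 4)%N -> N - k%:R != 0.
Proof.
by move=> k4; rewrite subr_eq0 eqr_nat neq_ltn (leq_trans k4) ?orbT.
Qed.

Let N0 : N != 0. Proof. by have := @n_neq 0 isT; rewrite subr0. Qed.
Let N1 : N - 1 != 0. Proof. exact: (@n_neq 1). Qed.
Let N2 : N - 2 != 0. Proof. exact: (@n_neq 2). Qed.
Let ND : N ^+ 2 - 3 * N + 1 != 0. Proof. exact: denominator_neq0. Qed.

(** * Moments determined by column sums alone *)

Lemma moment_a i a : moment [:: (i, a)] = N^-1.
Proof.
have := @moment_colsum [::] [::] i [::] a isT isT isT.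
rewrite big_nil add0r subr0 /= moment_nil => E.
by apply: (mulfI N0); rewrite E mulfV.
Qed.

(** Summing over the column of the second letter, the column a contributes 0 by orthogonality, and
    the [n - 1] others contribute equally. The next lemmas vary this argument. *)
Lemma moment_ab i j a b : i != j -> a != b ->
  moment [:: (i, a); (j, b)] = (N * (N - 1))^-1.
Proof.
move=> ij ab; have := @moment_colsum [:: (i, a)] [::] j [:: a] b isT.
rewrite /= !inE eq_sym ab eqxx => /(_ isT isT).
rewrite big_seq1 (@moment_col_orth [::]) // add0r moment_a => E.
by apply: (mulfI N1); rewrite E; field; rewrite N0 N1.
Qed.

Lemma moment_aba i j a b : i != j -> a != b ->
  moment [:: (i, a); (j, b); (i, a)] = (N * (N - 1))^-1.
Proof.
move=> ij ab; have := @moment_colsum [:: (i, a)] [:: (i, a)] j [:: a] b isT.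
rewrite /= !inE eq_sym ab eqxx => /(_ isT isT).
rewrite big_seq1 (@moment_col_orth [::]) // (@moment_idem [::]) moment_a add0r.
by move=> E; apply: (mulfI N1); rewrite E; field; rewrite N0 N1.
Qed.

(** Summing over the middle column leaves a product of two entries of column a in distinct rows,
    which is 0. *)
Lemma moment_abc_aba i j k a b : i != j -> i != k -> a != b ->
  moment [:: (i, a); (j, b); (k, a)] = 0.
Proof.
move=> ij ik ab; have := @moment_colsum [:: (i, a)] [:: (k, a)] j [:: a] b isT.
rewrite /= !inE eq_sym ab eqxx => /(_ isT isT).
rewrite big_seq1 !(@moment_col_orth [::]) // add0r => E.
by apply: (mulfI N1); rewrite E mulr0.
Qed.

Lemma moment_abc i j k a b c : uniq [:: i; j; k] -> uniq [:: a; b; c] ->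
  moment [:: (i, a); (j, b); (k, c)] = (N * (N - 1) * (N - 2))^-1.
Proof.
rewrite /= !inE !negb_or !andbT.
move=> /andP[/andP[ij ik] jk] /andP[/andP[ab ac] bc].
have := @moment_colsum [:: (i, a); (j, b)] [::] k [:: a; b] c.
rewrite /= !inE !eqxx orbT negb_or ab ![c == _]eq_sym ac bc => /(_ isT isT isT).
rewrite big_cons big_seq1 moment_abc_aba // (@moment_col_orth [:: (i, a)]) //.
rewrite !add0r moment_ab // => E.
by apply: (mulfI N2); rewrite E; field; rewrite N0 N1 N2.
Qed.

Lemma moment_abca i j k a b c : uniq [:: i; j; k] -> uniq [:: a; b; c] ->
  moment [:: (i, a); (j, b); (k, c); (i, a)] = (N * (N - 1) * (N - 2))^-1.
Proof.
rewrite /= !inE !negb_or !andbT.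
move=> /andP[/andP[ij ik] jk] /andP[/andP[ab ac] bc].
have := @moment_colsum [:: (i, a)] [:: (k, c); (i, a)] j [:: a; c] b.
rewrite /= !inE !eqxx orbT negb_or ac ![b == _]eq_sym ab eq_sym bc.
move=> /(_ isT isT isT).
(* The inserted letter is orthogonal to its left neighbour in column a and to its right neighbour in
   column c. *)
rewrite big_cons big_seq1 (@moment_col_orth [::]) //.
rewrite (@moment_col_orth [:: (i, a)]) // !add0r moment_aba // => E.
by apply: (mulfI N2); rewrite E; field; rewrite N0 N1 N2.
Qed.

(* The four left-hand sides are the values of one function of the column indices
   on abcd, abad, abcb and abab. Column sums give three linear equations, with
   right-hand sides al, be, ga, and [crossing] is the fourth one. *)
Lemma moment_alternating i1 i2 i3 i4 a b c d (D := N ^+ 2 - 3 * N + 1)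
    (al := moment [:: (i1, a); (i2, b); (i3, a)])
    (be := moment [:: (i1, a); (i2, b); (i4, d)])
    (ga := moment [:: (i1, a); (i3, c); (i4, d)])
    (v := ((N - 1) * be + ga - al) / D) :
    [&& i1 != i2, i2 != i3 & i3 != i4] -> uniq [:: a; b; c; d] ->
  [/\ moment [:: (i1, a); (i2, b); (i3, c); (i4, d)] = v,
      moment [:: (i1, a); (i2, b); (i3, a); (i4, d)] = be - (N - 3) * v,
      moment [:: (i1, a); (i2, b); (i3, c); (i4, b)] = ga - (N - 3) * v &
      moment [:: (i1, a); (i2, b); (i3, a); (i4, b)] =
        al - (N - 2) * (be - (N - 3) * v)].
Proof.
move=> /and3P[i12 i23 i34].
rewrite /= !inE !negb_or !andbT => /and3P[/and3P[ab ac ad] /andP[bc bd] cd].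
have [ba da dc] : [/\ b != a, d != a & d != c] by split; rewrite eq_sym.
(* Here a and c are the columns of the odd positions, b and d those of the even ones. The column
   sums that follow run over positions 4, 2 and 3. *)
have := @crossing i1 i2 i3 i4 a c b d.
rewrite /= !inE !negb_or ab ac ad bd cd [c == b]eq_sym bc => /(_ isT).
have := @moment_colsum [:: (i1, a); (i2, b); (i3, a)] [::] i4 [:: a; b] d.
rewrite /= !inE !eqxx orbT negb_or ab ![d == _]eq_sym ad bd => /(_ isT isT isT).
rewrite big_cons big_seq1 (@moment_col_orth [:: _; _]) // add0r -/al.
have := @moment_colsum [:: (i1, a)] [:: (i3, c); (i4, d)] i2 [:: a; c; d] b.
rewrite /= !inE !eqxx !orbT !negb_or ac ad cd [b == a]eq_sym ab bc bd.
move=> /(_ isT isT isT).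
rewrite !big_cons big_nil (@moment_col_orth [::]) //.
rewrite (@moment_col_orth [:: _]) // !add0r addr0 -/ga.
(* Exchanging b and d turns the column pattern adcd into abcb. *)
rewrite -(moment_tperm b d [:: _; (i2, d); _; _]) /= tpermR !tpermD //.
have := @moment_colsum [:: (i1, a); (i2, b)] [:: (i4, d)] i3 [:: a; b; d] c.
rewrite /= !inE !eqxx !orbT !negb_or ab ad bd.
rewrite [c == a]eq_sym ac [c == b]eq_sym bc cd => /(_ isT isT isT).
rewrite !big_cons big_nil (@moment_col_orth [:: _]) //.
rewrite (@moment_col_orth [:: _; _]) // !addr0 -/be.
set V := moment [:: (i1, a); (i2, b); (i3, c); (i4, d)].
set X := moment [:: _; _; (i3, a); (i4, b)].
set Y := moment [:: _; _; (i3, a); (i4, d)].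
set Z := moment [:: _; _; (i3, c); (i4, b)] => E3 E2 E1 E0.
(* Eliminating [X], [Y] and [Z] leaves [V] with the coefficient (N - 1)(N - 3) + (N - 2), which is
   the denominator [D]. *)
have Vv : V = v.
  apply: (mulIf ND); rewrite /v divfK // -E1 -E2 -E3.
  by apply/eqP; rewrite -subr_eq0 -E0; apply/eqP; ring.
by split=> //; rewrite -Vv -?E1 -?E2 -?E3; ring.
Qed.

(** * Diagonal words of degree four *)

Local Notation D := (N ^+ 2 - 3 * N + 1).

Definition diag (s : seq 'I_n) := [seq (i, i) | i <- s].

(** The columns c and d only complete a and b to four distinct ones. The terms [be] and [ga] contain
    adjacent entries of one row in distinct columns and vanish, so only [al] remains. *)
Lemma moment_abab a b : a != b ->
  moment (diag [:: a; b; a; b]) = (2 * N - 5) / (N * (N - 1) * D).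
Proof.
move=> ab; have [c cP] : exists c, c \notin [:: a; b].
  by apply: exists_notin; rewrite (leq_trans _ n_ge4).
have [d dP] : exists d, d \notin [:: a; b; c] by apply: exists_notin.
move: cP dP; rewrite !inE !negb_or => /andP[ca cb] /and3P[da db dc].
have [||_ _ _ ->] := @moment_alternating a b a b a b c d.
- by rewrite ab eq_sym ab.
- by rewrite /= !inE !negb_or ab ![_ == c]eq_sym ![_ == d]eq_sym ca cb da db dc.
rewrite (@moment_row_orth [:: _]) 1?eq_sym //.
rewrite (@moment_row_orth [::]) 1?eq_sym // moment_aba //.
by field; rewrite N0 N1 ND.
Qed.

Lemma moment_abac a b c : uniq [:: a; b; c] ->
  moment (diag [:: a; b; a; c]) = (N - 2) / (N * (N - 1) * D).
Proof.
move=> abc.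
have [d dP] : exists d, d \notin [:: a; b; c] by apply: exists_notin.
move: (abc) dP; rewrite /= !inE !negb_or !andbT.
move=> /andP[/andP[ab ac] bc] /and3P[da db dc].
(* The spare column d takes the third slot, so that the second value has the columns a, b, a, c of
   the word. *)
have [||_ -> _ _] := @moment_alternating a b a c a b d c.
- by rewrite ab eq_sym ab.
- by rewrite /= !inE !negb_or ab ![_ == d]eq_sym da db dc ac bc.
rewrite (@moment_row_orth [::]) 1?eq_sym // moment_aba // moment_abc //.
by field; rewrite N0 N1 N2 ND.
Qed.

Lemma moment_abcb a b c : uniq [:: a; b; c] ->
  moment (diag [:: a; b; c; b]) = (N - 2) / (N * (N - 1) * D).
Proof.
move=> abc.
have [d dP] : exists d, d \notin [:: a; b; c] by apply: exists_notin.
move: (abc) dP; rewrite /= !inE !negb_or !andbT.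
move=> /andP[/andP[ab ac] bc] /and3P[da db dc].
have [||_ _ -> _] := @moment_alternating a b c b a b c d.
- by rewrite ab bc eq_sym bc.
- by rewrite /= !inE !negb_or ab ![_ == d]eq_sym da db dc ac bc.
rewrite (@moment_row_orth [:: _]) 1?eq_sym // moment_abc_aba // moment_abc.
- by field; rewrite N0 N1 N2 ND.
- by rewrite /= !inE !negb_or ab ac eq_sym bc.
- by rewrite /= !inE !negb_or ac ![_ == d]eq_sym da dc.
Qed.

Lemma moment_abcd a b c d : uniq [:: a; b; c; d] ->
  moment (diag [:: a; b; c; d]) = ((N - 1) * (N - 2) * D)^-1.
Proof.
move=> abcd; move: (abcd); rewrite /= !inE !negb_or !andbT.
move=> /and3P[/and3P[ab ac ad] /andP[bc bd] cd].
have [||-> _ _ _] := @moment_alternating a b c d a b c d.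
- by rewrite ab bc cd.
- by [].
rewrite moment_abc_aba // !moment_abc /= ?inE ?negb_or ?ab ?ac ?ad ?bd ?cd //.
by field; rewrite N0 N1 N2 ND.
Qed.

(** * Moments of the truncated character *)

Variables (s : nat) (s_le : (s <= n)%N).
Local Notation S := (s%:R : R[i]).
Local Notation X := (truncated_character s u).

(* [h (X ^+ k)] is computed by expanding one factor [X] at a time, according to
   which of the previous indices, collected in [t], the new one equals. *)
Definition prefixed_moment (t : seq 'I_n) k := h (word (diag t) * X ^+ k).
Local Notation G := prefixed_moment.

Lemma prefixed_moment0 t : G t 0 = moment (diag t).
Proof. by rewrite /G expr0 mulr1. Qed.

Lemma prefixed_moment_idem t a k : G (rcons (rcons t a) a) k = G (rcons t a) k.
Proof.
rewrite /G /diag !map_rcons -!cats1 !word_cat /word !big_seq1 /=.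
by rewrite -[_ * u a a * u a a]mulrA (magic_proj magic a a).2.
Qed.

(** The leading factor of the power is expanded: its indices in [cs] are kept as they are, and the
    fresh ones below [s] share the value [v]. *)
Lemma prefixed_momentS t k cs v :
    uniq cs -> all (fun i : 'I_n => (i < s)%N) cs ->
    (forall x : 'I_n, (x < s)%N -> x \notin cs -> G (rcons t x) k = v) ->
  G t k.+1 = \sum_(x <- cs) G (rcons t x) k + (S - (size cs)%:R) * v.
Proof.
move=> cs_uniq cs_s Gv.
transitivity (\sum_(x : 'I_n | (x < s)%N) G (rcons t x) k).
  rewrite /G exprS /truncated_character mulrA mulr_sumr mulr_suml linear_sum.
  apply: eq_bigr => x _; rewrite /diag map_rcons -cats1 word_cat.
  by rewrite /word big_seq1.
rewrite (sum_uniq_const cs_uniq cs_s Gv); congr (_ + (_%:R - _) * _).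
(* As [s] is at most [n], exactly [s] ordinals lie below it. *)
by rewrite -sum1_card (big_ord_narrow s_le) sum1_card card_ord.
Qed.

(* The moments of the index patterns ab and aba; abc and abca; abac and abcb;
   abab; abcd. *)
Local Notation bm := ((N * (N - 1))^-1).
Local Notation em := ((N * (N - 1) * (N - 2))^-1).
Local Notation ym := ((N - 2) / (N * (N - 1) * D)).
Local Notation xm := ((2 * N - 5) / (N * (N - 1) * D)).
Local Notation vm := (((N - 1) * (N - 2) * D)^-1).

Lemma prefixed_moment_a1 (a : 'I_n) : (a < s)%N ->
  G [:: a] 1 = N^-1 + (S - 1) * bm.
Proof.
move=> a_s; rewrite (@prefixed_momentS _ _ [:: a] bm) /= ?a_s //.
  by rewrite big_seq1 (@prefixed_moment_idem [::]) prefixed_moment0 moment_a.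
by move=> x _; rewrite inE eq_sym => ax; rewrite prefixed_moment0 moment_ab.
Qed.

Lemma prefixed_moment_ab1 (a b : 'I_n) : (a < s)%N -> (b < s)%N -> a != b ->
  G [:: a; b] 1 = 2 * bm + (S - 2) * em.
Proof.
move=> a_s b_s ab; rewrite (@prefixed_momentS _ _ [:: a; b] em) /= ?a_s ?b_s //.
- rewrite big_cons big_seq1 (@prefixed_moment_idem [:: a]) /=.
  rewrite !prefixed_moment0.
  by rewrite moment_aba // moment_ab // [2 * bm]mulr_natl [bm *+ 2]mulr2n.
- by rewrite inE ab.
move=> x _ abx; rewrite prefixed_moment0 moment_abc // (rcons_uniq [:: a; b]);
by rewrite abx /= inE ab.
Qed.

Lemma prefixed_moment_aba1 (a b : 'I_n) : (a < s)%N -> (b < s)%N -> a != b ->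
  G [:: a; b; a] 1 = bm + xm + (S - 2) * ym.
Proof.
move=> a_s b_s ab; rewrite (@prefixed_momentS _ _ [:: a; b] ym) /= ?a_s ?b_s //.
- rewrite big_cons big_seq1 (@prefixed_moment_idem [:: a; b]) /=.
  rewrite !prefixed_moment0.
  by rewrite moment_aba // moment_abab.
- by rewrite inE ab.
move=> x _ abx; rewrite prefixed_moment0 moment_abac //.
by rewrite (rcons_uniq [:: a; b]) abx /= inE ab.
Qed.

Lemma prefixed_moment_abc1 (a b c : 'I_n) :
    all (fun i : 'I_n => (i < s)%N) [:: a; b; c] -> uniq [:: a; b; c] ->
  G [:: a; b; c] 1 = 2 * em + ym + (S - 3) * vm.
Proof.
move=> abc_s abc; rewrite (@prefixed_momentS _ _ [:: a; b; c] vm) //.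
  (* Repeating a, b or c gives the patterns abca, abcb and, by idempotence, abc. *)
  rewrite !big_cons big_nil (@prefixed_moment_idem [:: a; b]) /=.
  rewrite !prefixed_moment0.
  by rewrite moment_abca // moment_abcb // moment_abc // addr0; ring.
move=> x _ abcx; rewrite prefixed_moment0 moment_abcd //.
by rewrite (rcons_uniq [:: a; b; c]) abcx.
Qed.

Lemma prefixed_moment_a2 (a : 'I_n) : (a < s)%N ->
  G [:: a] 2 = N^-1 + (S - 1) * bm + (S - 1) * (2 * bm + (S - 2) * em).
Proof.
move=> a_s.
rewrite (@prefixed_momentS _ _ [:: a] (2 * bm + (S - 2) * em)) /= ?a_s //.
  by rewrite big_seq1 (@prefixed_moment_idem [::]) prefixed_moment_a1.
by move=> x x_s; rewrite inE eq_sym => ax; rewrite prefixed_moment_ab1.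
Qed.

Lemma prefixed_moment_ab2 (a b : 'I_n) : (a < s)%N -> (b < s)%N -> a != b ->
  G [:: a; b] 2 = bm + xm + (S - 2) * ym + (2 * bm + (S - 2) * em)
                  + (S - 2) * (2 * em + ym + (S - 3) * vm).
Proof.
move=> a_s b_s ab.
rewrite (@prefixed_momentS _ _ [:: a; b] (2 * em + ym + (S - 3) * vm)) /=
  ?a_s ?b_s //.
- rewrite big_cons big_seq1 (@prefixed_moment_idem [:: a]) /=.
  by rewrite prefixed_moment_aba1 // prefixed_moment_ab1.
- by rewrite inE ab.
move=> x x_s abx; rewrite prefixed_moment_abc1 //.
  by rewrite /= a_s b_s x_s.
by rewrite (rcons_uniq [:: a; b]) abx /= inE ab.
Qed.

Lemma prefixed_moment_a3 (a : 'I_n) : (a < s)%N ->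
  G [:: a] 3 = N^-1 + (S - 1) * bm + (S - 1) * (2 * bm + (S - 2) * em)
    + (S - 1) * (bm + xm + (S - 2) * ym + (2 * bm + (S - 2) * em)
                 + (S - 2) * (2 * em + ym + (S - 3) * vm)).
Proof.
move=> a_s.
rewrite (@prefixed_momentS _ _ [:: a] (bm + xm + (S - 2) * ym
  + (2 * bm + (S - 2) * em) + (S - 2) * (2 * em + ym + (S - 3) * vm))) /=
  ?a_s //.
  by rewrite big_seq1 (@prefixed_moment_idem [::]) prefixed_moment_a2.
by move=> x x_s; rewrite inE eq_sym => ax; rewrite prefixed_moment_ab2.
Qed.

Lemma prefixed_moment_nil k v :
    (forall a : 'I_n, (a < s)%N -> G [:: a] k = v) ->
  h (X ^+ k.+1) = S * v.
Proof.
(* The recursion starts at the empty word, where every index is fresh; this is the source of the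
   factor [S]. *)
move=> Gv; rewrite -[X ^+ _]mul1r -[1](_ : word (diag [::]) = 1); last first.
  by rewrite /word big_nil.
rewrite -/(G [::] k.+1) (@prefixed_momentS _ _ [::] v) // => [|x xs _].
  by rewrite big_nil add0r subr0.
exact: Gv.
Qed.

End HaarWords.

Theorem theorem3p1 (R : realType) (n s : nat)
    (hn : (4 <= n)%N) (hs : (1 <= s <= n)%N)
    (A : cstarType R) (u : 'M[A]_n) (hA : quantum_permutation_algebra u)
    (T : cstarType R) (l r : {lrmorphism A -> T}) (hT : cstar_tensor l r)
    (Delta : {lrmorphism A -> T}) (hDelta : is_comultiplication l r u Delta)
    (h : {scalar A}) (hh : is_haar_state l r Delta h) :
  let X := truncated_character s u in
  let N : R[i] := n%:R in
  let S : R[i] := s%:R in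
  let P : R[i] :=
    N ^+ 4 + (6 * S - 12) * N ^+ 3 + (6 * S ^+ 2 - 46 * S + 52) * N ^+ 2
    + (S ^+ 3 - 26 * S ^+ 2 + 104 * S - 88) * N
    + (12 * S ^+ 2 - 38 * S + 28) in
  [/\ h X = S / N,
      h (X ^+ 2) = S / N * ((N + (S - 2)) / (N - 1)),
      h (X ^+ 3) = S / N *
        ((N ^+ 2 + 3 * (S - 2) * N + (S ^+ 2 - 9 * S + 10)) /
         ((N - 1) * (N - 2))) &
      h (X ^+ 4) = S / N *
        (P / ((N - 1) * (N - 2) * (N ^+ 2 - 3 * N + 1)))].
Proof.
move=> X N S P; have /andP[_ s_le] := hs.
have n_neq k : (k < 4)%N -> N - k%:R != 0.
  by move=> k4; rewrite subr_eq0 eqr_nat neq_ltn (leq_trans k4) ?orbT.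
have N0 : N != 0 by have := n_neq 0%N isT; rewrite subr0.
have N1 : N - 1 != 0 by exact: (n_neq 1%N).
have N2 : N - 2 != 0 by exact: (n_neq 2%N).
have ND : N ^+ 2 - 3 * N + 1 != 0 by exact: denominator_neq0.
split.
- rewrite -[X]expr1 (prefixed_moment_nil s_le (v := N^-1)) // => a a_s.
  by rewrite prefixed_moment0 (moment_a hA hT hDelta hh).
- rewrite (prefixed_moment_nil s_le
             (prefixed_moment_a1 hA hT hDelta hh hn s_le)).
  by field; rewrite N0 N1.
- rewrite (prefixed_moment_nil s_le
             (prefixed_moment_a2 hA hT hDelta hh hn s_le)).
  by field; rewrite N0 N1 N2.
rewrite (prefixed_moment_nil s_le (prefixed_moment_a3 hA hT hDelta hh hn s_le)).
by rewrite /P; field; rewrite N0 N1 N2 ND.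
Qed.
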